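(* Let $\mathcal{E}$ be a Hilbert space, and let $k:\mathbb{D}\times\mathbb{D}\to\mathcal{B}(\mathcal{E})$ be an analytic kernel. Assume that the shift $M_z$ is left-invertible on $\mathcal{H}_k$. Then $$\langle\tilde k(z,w)\eta,\zeta\rangle_{\mathcal{E}}=\big\langle|M_z|^{-1}(k(\cdot,w)\eta),\,k(\cdot,z)\zeta\big\rangle_{\mathcal{H}_k}\qquad(z,w\in\mathbb{D},\ \eta,\zeta\in\mathcal{E})$$ defines a kernel $\tilde k:\mathbb{D}\times\mathbb{D}\to\mathcal{B}(\mathcal{E})$. Moreover, the shift $M_z$ on $\mathcal{H}_{\tilde k}$ defines a bounded linear operator, and there exists a unitary $U:\mathcal{H}_k\to\mathcal{H}_{\tilde k}$ such that $U\tilde M_z=M_zU$, where $\tilde M_z$ is the Aluthge transform of $M_z$ on $\mathcal{H}_k$ and $M_z$ on the right-hand side is the shift on $\mathcal{H}_{\tilde k}$.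
   Context: $\mathbb{D}$ is the open unit disc. An analytic kernel $k:\mathbb{D}\times\mathbb{D}\to\mathcal{B}(\mathcal{E})$ is a positive definite kernel that is analytic in the first variable; $\mathcal{H}_k$ is its reproducing kernel Hilbert space of $\mathcal{E}$-valued analytic functions on $\mathbb{D}$ (with $\langle f,k(\cdot,w)\eta\rangle_{\mathcal{H}_k}=\langle f(w),\eta\rangle_{\mathcal{E}}$), and the shift $(M_zf)(w)=wf(w)$ is assumed to be bounded on $\mathcal{H}_k$. For a bounded operator $T$ on a Hilbert space: $|T|=(T^*T)^{1/2}$; $T=V|T|$ is the polar decomposition with $V$ the unique partial isometry with $\ker V=\ker T$; the Aluthge transform is $\tilde T=|T|^{1/2}V|T|^{1/2}$. $T$ is left-invertible if $XT=I$ for some bounded $X$ (equivalently $T^*T$, hence $|T|$, is invertible). *)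

(* Defs.v *)
From HB Require Import structures.
From mathcomp Require Import all_boot all_order all_algebra sesquilinear.
From mathcomp Require Import boolp classical_sets functions.
From mathcomp Require Import topology normedtype derive.

Set Implicit Arguments.
Unset Strict Implicit.
Unset Printing Implicit Defensive.

Import Order.TTheory GRing.Theory Num.Theory.
Import numFieldNormedType.Exports.

Local Open Scope classical_set_scope.
Local Open Scope ring_scope.

(* Everything is stated over an abstract [C : numClosedFieldType], because the
   topology of a field is canonical on such a [C] but not on [R[i]] written
   literally; the complex numbers are obtained at [C := R[i]], [R : realType]. *)

(* The library's forms are linear in the first variable and conjugate-linear
   in the second. *)
HB.mixin Record CompleteNormedModule_isHilbert (C : numClosedFieldType) E
    of CompleteNormedModule C E := {
  inner : {dot E for @Num.conj C};
  normrE_inner : forall x : E, `|x| ^+ 2 = inner x x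
}.

#[short(type="hilbertType")]
HB.structure Definition Hilbert (C : numClosedFieldType) :=
  {E of CompleteNormedModule C E & CompleteNormedModule_isHilbert C E}.

(* B(E, F); for linear maps of normed spaces bounded and continuous are the
   same ([linear_bounded_continuous]). *)
Record bop (C : numClosedFieldType) (E F : hilbertType C) := Bop {
  bop_fun :> {linear E -> F};
  bop_continuous : continuous bop_fun
}.

HB.instance Definition _ (C : numClosedFieldType) (E F : hilbertType C) :=
  gen_eqMixin (bop E F).
HB.instance Definition _ (C : numClosedFieldType) (E F : hilbertType C) :=
  gen_choiceMixin (bop E F).

Section Operators.
Variable C : numClosedFieldType.
Implicit Types E F G : hilbertType C.

Lemma bop0_continuous E F : continuous (\0 : {linear E -> F}).
Proof. exact: cst_continuous. Qed.

Definition bop0 E F : bop E F := Bop (@bop0_continuous E F).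

Lemma bop_comp_continuous E F G (S : bop F G) (T : bop E F) :
  continuous (bop_fun S \o bop_fun T).
Proof.
by move=> x; apply: continuous_comp; apply: bop_continuous.
Qed.

Definition bop_comp E F G (S : bop F G) (T : bop E F) : bop E G :=
  Bop (@bop_comp_continuous _ _ _ S T).

Local Notation "S ** T" := (bop_comp S T) (at level 40, left associativity).

Definition left_invertible E F (T : bop E F) :=
  exists X : bop F E, forall x, X (T x) = x.

Definition unitary E F (U : bop E F) :=
  (forall x y, inner (U x) (U y) = inner x y) /\ (forall y, exists x, U x = y).

(* The operators below are picked by a description which at most one operator
   satisfies; the default [bop0] is used when there is none. *)

Definition adjoint E F (T : bop E F) : bop F E :=
  xget (bop0 F E) [set S : bop F E | forall x y, inner (T x) y = inner x (S y)].

Definition bop_inv E F (T : bop E F) : bop F E :=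
  xget (bop0 F E) [set S : bop F E |
    (forall x, S (T x) = x) /\ (forall y, T (S y) = y)].

Definition positive_op E (T : bop E E) := forall x, 0 <= inner (T x) x.

Definition sqrt_op E (T : bop E E) : bop E E :=
  xget (bop0 E E) [set S : bop E E |
    positive_op S /\ forall x, S (S x) = T x].

Definition modulus E F (T : bop E F) : bop E E := sqrt_op (adjoint T ** T).

Definition partial_isometry E F (V : bop E F) :=
  forall x, (forall y, V y = 0 -> inner x y = 0) -> `|V x| = `|x|.

Definition polar_isometry E F (T : bop E F) : bop E F :=
  xget (bop0 E F) [set V : bop E F |
    [/\ partial_isometry V, (forall x, V x = 0 <-> T x = 0)
      & forall x, T x = V (modulus T x)]].

Definition aluthge E (T : bop E E) : bop E E :=
  sqrt_op (modulus T) ** polar_isometry T ** sqrt_op (modulus T).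

End Operators.

Section Kernels.
Variable C : numClosedFieldType.

Definition disc : set C := [set z | `|z| < 1].

Variable E : hilbertType C.

(* Functions and kernels on the disc are total functions on [C]; their values
   outside [disc] are never used. *)

Definition analytic_on_disc (f : C -> E) := forall z, disc z -> derivable f z 1.

(* Complex differentiability for the operator norm, with
   [`|A| <= e] spelled out as [forall x, `|A x| <= e * `|x|]. *)
Definition op_analytic_on_disc (f : C -> bop E E) :=
  forall z, disc z -> exists D : bop E E, forall e : C, 0 < e ->
    \forall h \near 0^', forall x : E,
      `|h^-1 *: (f (z + h) x - f z x) - D x| <= e * `|x|.

Definition pd_kernel (k : C -> C -> bop E E) :=
  forall (n : nat) (z : 'I_n -> C) (x : 'I_n -> E), (forall i, disc (z i)) ->
    0 <= \sum_(i < n) \sum_(j < n) inner (k (z i) (z j) (x j)) (x i).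

Definition analytic_kernel (k : C -> C -> bop E E) :=
  pd_kernel k /\ forall w, disc w -> op_analytic_on_disc (k ^~ w).

(* The reproducing kernel Hilbert space of [k]: a Hilbert space whose elements
   are, through [rkhs_fun], analytic functions on the disc, two elements being
   equal when they are equal as functions on the disc.
   [kernel_at w x] is the element k(., w)x. *)
Record rkhs (k : C -> C -> bop E E) := Rkhs {
  rkhs_space :> hilbertType C;
  rkhs_fun : {linear rkhs_space -> (C -> E)};
  rkhs_fun_inj : forall f g,
    (forall z, disc z -> rkhs_fun f z = rkhs_fun g z) -> f = g;
  rkhs_analytic : forall f, analytic_on_disc (rkhs_fun f);
  kernel_at : C -> E -> rkhs_space;
  kernel_atE : forall z w x, disc z -> disc w ->
    rkhs_fun (kernel_at w x) z = k z w x;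
  reproducing : forall f w x, disc w ->
    inner f (kernel_at w x) = inner (rkhs_fun f w) x
}.

(* [M] is the shift f |-> z f; such an [M] is unique, and it exists exactly
   when the shift is a bounded operator on [H]. *)
Definition is_shift (k : C -> C -> bop E E) (H : rkhs k) (M : bop H H) :=
  forall f w, disc w -> rkhs_fun H (M f) w = w *: rkhs_fun H f w.

End Kernels.

Arguments disc {C}.

(* Main.v *)
From HB Require Import structures.
Require Import Defs.
From mathcomp Require Import all_boot all_order all_algebra sesquilinear.
From mathcomp Require Import complex.
From mathcomp Require Import boolp classical_sets functions reals topology.
From mathcomp Require Import normedtype derive.
From mathcomp Require Import sequences ring lra.

(** Write P = |M| and S = P^(1/2).  Left-invertibility of M makes M* M bounded
    below, hence P and S are invertible, and M = V P with V = M P^-1.  Then the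
    Aluthge transform satisfies

        S^-1 (S V S) = V S = V P S^-1 = M S^-1,

    so S^-1 intertwines it with M.  Let H0 be the Hilbert space H in which an
    element f is read as the function (S^-1 f)(z), instead of f(z).  By the
    identity above the Aluthge transform of M acts on these functions as
    multiplication by z.  Since S^-1 is self-adjoint,
    <(S^-1 f)(w), x> = <f, S^-1 k(., w) x>, so H0 has the reproducing kernel

        (z, w) |-> (S^-1 S^-1 k(., w) x)(z) = (P^-1 k(., w) x)(z),

    which is the kernel of the theorem ([transported_rkhs]).  It is positive
    definite because P^-1 is positive ([operator_kernel_pd]).  A space with a
    given reproducing kernel is unique up to a unitary that preserves the values
    of functions ([rkhs_unique]), which carries the result from H0 to any other
    reproducing kernel Hilbert space of that kernel.

    The operator theory behind this is built for operators bounded below, where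
    it is elementary.  Adjoints come from the Riesz representation, that is, from
    orthogonal projection ([adjointE]).  If A is symmetric with
    <A x, x> >= c |x|^2, then 1 - t A is a strict contraction for a small t > 0
    ([coercive_contraction]); from it the inverse of A arises as a Neumann
    iteration ([coercive_surjective]), and its square root as the fixed point of
    Y |-> (B + Y^2) / 2 with B = 1 - t A ([contraction_fixpoint]).  The square
    root is bounded below again ([sqrt_op_coercive]), so that the construction
    applies to M* M and then to P. *)

Set Implicit Arguments.
Unset Strict Implicit.
Unset Printing Implicit Defensive.

Import Order.TTheory GRing.Theory Num.Theory.
Import numFieldNormedType.Exports.

Local Open Scope ring_scope.
Local Open Scope complex_scope.

Local Notation Re := complex.Re.

(** * Complex inner products seen as real ones *)

Section Inner.
Variable R : realType.
Implicit Types E F : hilbertType R[i].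

Lemma innerDl E (x y z : E) : inner (x + y) z = inner x z + inner y z.
Proof. exact: linearDl. Qed.

Lemma innerDr E (x y z : E) : inner x (y + z) = inner x y + inner x z.
Proof. exact: linearDr. Qed.

Lemma innerBl E (x y z : E) : inner (x - y) z = inner x z - inner y z.
Proof. exact: linearBl. Qed.

Lemma innerBr E (x y z : E) : inner x (y - z) = inner x y - inner x z.
Proof. exact: linearBr. Qed.

Lemma innerZl E a (x y : E) : inner (a *: x) y = a * inner x y.
Proof. exact: linearZl_LR. Qed.

Lemma innerZr E a (x y : E) : inner x (a *: y) = a^*%C * inner x y.
Proof. exact: linearZr_LR. Qed.

Lemma innerC E (x y : E) : inner x y = (inner y x)^*%C.
Proof. by rewrite (hermC (@inner _ E)) expr0 mul1r. Qed.

Lemma inner0l E (y : E) : inner 0 y = 0. Proof. exact: linear0l. Qed.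

Lemma inner_suml E I (r : seq I) (P : pred I) (F : I -> E) y :
  inner (\sum_(i <- r | P i) F i) y = \sum_(i <- r | P i) inner (F i) y.
Proof. exact: linear_sumlz. Qed.

Lemma inner_sumr E I (r : seq I) (P : pred I) (F : I -> E) y :
  inner y (\sum_(i <- r | P i) F i) = \sum_(i <- r | P i) inner y (F i).
Proof. exact: linear_sumr. Qed.

(** The real Hilbert space underlying a complex one.  The order of R[i] is only
    partial, so estimates are carried out in R. *)
Definition rinner E (x y : E) : R := Re (inner x y).
Definition rnorm E (x : E) : R := Re `|x|.

Lemma rnormE E (x : E) : `|x| = (rnorm x)%:C.
Proof. by rewrite RRe_real // ger0_real. Qed.

Lemma innerxx E (x : E) : inner x x = (rnorm x ^+ 2)%:C.
Proof. by rewrite -normrE_inner rnormE rmorphXn. Qed.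

Lemma rnorm_ge0 E (x : E) : 0 <= rnorm x.
Proof. by rewrite -ler0c -rnormE. Qed.

Lemma rinnerxx E (x : E) : rinner x x = rnorm x ^+ 2.
Proof. by rewrite /rinner innerxx. Qed.

Lemma rinnerDl E (x y z : E) : rinner (x + y) z = rinner x z + rinner y z.
Proof. by rewrite /rinner innerDl raddfD. Qed.

Lemma rinnerBl E (x y z : E) : rinner (x - y) z = rinner x z - rinner y z.
Proof. by rewrite /rinner innerBl raddfB. Qed.

Lemma rinnerC E (x y : E) : rinner x y = rinner y x.
Proof. by rewrite /rinner innerC; case: (inner y x). Qed.

Lemma rinnerDr E (x y z : E) : rinner x (y + z) = rinner x y + rinner x z.
Proof. by rewrite rinnerC rinnerDl !(rinnerC x). Qed.

Lemma rinnerBr E (x y z : E) : rinner x (y - z) = rinner x y - rinner x z.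
Proof. by rewrite rinnerC rinnerBl !(rinnerC x). Qed.

Lemma rinnerZl E (a : R) (x y : E) : rinner (a%:C *: x) y = a * rinner x y.
Proof.
by rewrite /rinner innerZl; case: (inner x y) => u v /=; rewrite mul0r subr0.
Qed.

Lemma rinnerZr E (a : R) (x y : E) : rinner x (a%:C *: y) = a * rinner x y.
Proof. by rewrite rinnerC rinnerZl rinnerC. Qed.

Lemma rinner_eq0 E (x y : E) :
  rinner x y = 0 -> rinner x ('i *: y) = 0 -> inner x y = 0.
Proof.
rewrite /rinner innerZr; case: (inner x y) => u v /= ->.
by rewrite mul0r sub0r mulN1r opprK => ->.
Qed.

(** The imaginary part of <x, y> is the real part of <x, iy>. *)
Lemma eq_inner E F (x y : E) (x' y' : F) : rinner x y = rinner x' y' ->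
  rinner x ('i%C *: y) = rinner x' ('i%C *: y') -> inner x y = inner x' y'.
Proof.
rewrite /rinner !innerZr; case: (inner x y) => a b; case: (inner x' y') => c d.
by move=> /= -> ; rewrite !mul0r !sub0r !mulN1r !opprK => ->.
Qed.

Lemma rinner_scale E (a : R[i]) (x y : E) :
  rinner x (a *: y) = rinner (a^*%C *: x) y.
Proof. by rewrite /rinner innerZl innerZr. Qed.

Lemma inner_inj E (x y : E) : (forall z, inner x z = inner y z) -> x = y.
Proof.
move=> h; apply/eqP; rewrite -subr_eq0 -(dnorm_eq0 (@inner _ E)).
by rewrite innerBl h subrr.
Qed.

Lemma innerNl E (x y : E) : inner (- x) y = - inner x y.
Proof. exact: linearNl. Qed.

Lemma rnormD E (x y : E) : rnorm (x + y) <= rnorm x + rnorm y.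
Proof. by rewrite -lecR rmorphD /= -!rnormE ler_normD. Qed.

Lemma rnorm0 E : rnorm (0 : E) = 0. Proof. by rewrite /rnorm normr0. Qed.

Lemma rnorm_eq0 E (x : E) : rnorm x = 0 -> x = 0.
Proof. by move=> h; apply/eqP; rewrite -normr_eq0 rnormE h. Qed.

Lemma rnormN E (x : E) : rnorm (- x) = rnorm x.
Proof. by rewrite /rnorm normrN. Qed.

Lemma rnormBC E (x y : E) : rnorm (x - y) = rnorm (y - x).
Proof. by rewrite -rnormN opprB. Qed.

Lemma rnormZ E (a : R) (x : E) : rnorm (a%:C *: x) = `|a| * rnorm x.
Proof.
rewrite /rnorm normrZ rnormE normc_def /= expr0n addr0 sqrtr_sqr.
by rewrite /= mul0r subr0.
Qed.

Lemma rnormB E (x y : E) : rnorm (x - y) <= rnorm x + rnorm y.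
Proof. by rewrite -(rnormN y) rnormD. Qed.

Lemma rnormB_sqr E (x y : E) :
  rnorm (x - y) ^+ 2 = rnorm x ^+ 2 - 2 * rinner x y + rnorm y ^+ 2.
Proof.
by rewrite -!rinnerxx rinnerBl !rinnerBr (rinnerC y x); ring.
Qed.

Lemma rnormD_sqr E (x y : E) :
  rnorm (x + y) ^+ 2 = rnorm x ^+ 2 + 2 * rinner x y + rnorm y ^+ 2.
Proof.
by rewrite -!rinnerxx rinnerDl !rinnerDr (rinnerC y x); ring.
Qed.

(** The squared norm of |y|^2 x - <x, y> y is nonnegative. *)
Lemma CauchySchwarz E (x y : E) : `|rinner x y| <= rnorm x * rnorm y.
Proof.
have [->|y0] := eqVneq y 0.
  by rewrite rnorm0 mulr0 /rinner linear0r normr0.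
have ny : 0 < rnorm y.
  by rewrite lt_def rnorm_ge0 andbT; apply: contra_neq y0; exact: rnorm_eq0.
have := sqr_ge0 (rnorm ((rnorm y ^+ 2)%:C *: x - (rinner x y)%:C *: y)).
rewrite rnormB_sqr !rnormZ !exprMn !real_normK ?num_real // rinnerZl rinnerZr.
set a := rnorm x; set b := rnorm y; set c := rinner x y => h.
have a0 : 0 <= a := rnorm_ge0 x.
have b0 := ltW ny.
rewrite -ler_sqr ?nnegrE ?mulr_ge0 // real_normK ?num_real // exprMn.
have b2 : 0 < b ^+ 2 by rewrite exprn_gt0.
have : 0 <= b ^+ 2 * (a ^+ 2 * b ^+ 2 - c ^+ 2) by apply: le_trans h _; lra.
by rewrite pmulr_rge0 // subr_ge0.
Qed.

Lemma bopD E F (T : bop E F) x y : T (x + y) = T x + T y.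
Proof. exact: linearD. Qed.

Lemma bopB E F (T : bop E F) x y : T (x - y) = T x - T y.
Proof. exact: linearB. Qed.

Lemma bopZ E F (T : bop E F) a x : T (a *: x) = a *: T x.
Proof. exact: linearZ_LR. Qed.

End Inner.

(** Identities between vectors are tested against inner products, where they
    become ring identities between scalars. *)
Ltac vector := by apply: inner_inj => ?;
  rewrite !(innerDl, innerNl, innerZl, inner0l); ring.

(** * Convergence with a rate, and bounded operators *)

Section Completeness.
Local Open Scope classical_set_scope.
Local Open Scope ring_scope.
Variable R : realType.
Implicit Types E F : hilbertType R[i].

(** Limits enter the proofs through estimates K * e n, where the rate e tends
    to 0. *)
Lemma le0_of_vanishing (e : nat -> R) K x : e @ \oo --> 0 ->
  (forall n, x <= K * e n) -> x <= 0.
Proof.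
move=> e0 h; have Ke : K * e n @[n --> \oo] --> (0 : R).
  by rewrite -(mulr0 K); apply: cvgM => //; exact: cvg_cst.
rewrite -(cvg_lim (@Rhausdorff R) Ke); apply: limr_ge; last exact: nearW.
by apply/cvg_ex; exists 0.
Qed.

Lemma le_of_vanishing (e : nat -> R) K x y : e @ \oo --> 0 ->
  (forall n, x <= y + K * e n) -> x <= y.
Proof.
move=> e0 h; rewrite -subr_le0; apply: (le0_of_vanishing e0) => n.
by rewrite lerBlDl; exact: h.
Qed.

Lemma eq_of_vanishing E (e : nat -> R) K (x y : E) : e @ \oo --> 0 ->
  (forall n, rnorm (x - y) <= K * e n) -> x = y.
Proof.
move=> e0 h; apply/eqP; rewrite -subr_eq0; apply/eqP/rnorm_eq0/le_anti.
by rewrite rnorm_ge0 (le0_of_vanishing e0 h).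
Qed.

(** The scalar a serves to recover the imaginary parts, with a = i; leaving it
    arbitrary makes the estimates of the real part carry over verbatim. *)
Lemma eq_inner_of_vanishing E F (x y : E) (x' y' : F) (e : nat -> R) :
  e @ \oo --> 0 ->
  (forall a : R[i], exists K, forall n,
     `|rinner x (a *: y) - rinner x' (a *: y')| <= K * e n) ->
  inner x y = inner x' y'.
Proof.
move=> e0 h.
have ra (a : R[i]) : rinner x (a *: y) = rinner x' (a *: y').
  have [K hK] := h a.
  apply/eqP; rewrite -subr_eq0 -normr_eq0 eq_le normr_ge0 andbT.
  exact: le0_of_vanishing e0 hK.
by apply: eq_inner; rewrite ?ra // -(scale1r y) ra scale1r.
Qed.

Lemma cvg_geometric0 (b : R) : 0 <= b -> b < 1 -> b ^+ n @[n --> \oo] --> 0.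
Proof. by move=> b0 b1; apply: cvg_expr; rewrite ger0_norm. Qed.

(** Keeping one rate in hypothesis and conclusion spares the choice of thresholds
    when several limits are combined. *)
Lemma complete_rate E (u : nat -> E) (e : nat -> R) : e @ \oo --> 0 ->
  (forall n m, (n <= m)%N -> rnorm (u m - u n) <= e n) ->
  exists l, forall n, rnorm (l - u n) <= e n.
Proof.
move=> e0 h; have : cauchy (u @ \oo).
  apply/cauchy_exP => -[d di]; rewrite ltcE /= => /andP[/eqP -> d0].
  move/cvgrPdist_lt: e0 => /(_ _ d0) /= [N _ /(_ N (leqnn N))].
  rewrite sub0r normrN => eN; exists (u N); exists N => // m /= Nm.
  rewrite -ball_normE /= rnormE ltcR rnormBC.
  exact: le_lt_trans (h _ _ Nm) (le_lt_trans (ler_norm _) eN).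
move/cauchy_cvg => ul; exists (lim (u @ \oo)) => n.
apply/ler_addgt0Pr => d d0.
move/cvgrPdist_lt: ul => /(_ d%:C); rewrite ltcR => /(_ d0) [N _ uN].
have := uN (maxn N n) (leq_maxl _ _); rewrite rnormE ltcR => /ltW hd.
have := h n (maxn N n) (leq_maxr _ _).
have := rnormD (lim (u @ \oo) - u (maxn N n)) (u (maxn N n) - u n).
rewrite subrKA => h1 h2; apply: le_trans h1 _.
by rewrite [leRHS]addrC; apply: lerD.
Qed.

(** Telescoping gives the Cauchy rate K (b^n - b^m) / (1 - b). *)
Lemma complete_geometric E (u : nat -> E) K b : 0 <= b -> b < 1 ->
  (forall n, rnorm (u n.+1 - u n) <= K * b ^+ n) ->
  exists l, forall n, rnorm (l - u n) <= K / (1 - b) * b ^+ n.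
Proof.
move=> b0 b1 h; have b1' : 0 < 1 - b by rewrite subr_gt0.
have K0 : 0 <= K / (1 - b).
  apply: divr_ge0 (ltW b1').
  by have := le_trans (rnorm_ge0 _) (h 0%N); rewrite expr0 mulr1.
apply: complete_rate.
  rewrite -(mulr0 (K / (1 - b))); apply: cvgM; first exact: cvg_cst.
  by apply: cvg_expr; rewrite ger0_norm.
move=> n m /subnK <-; set k := (m - n)%N.
have : rnorm (u (k + n)%N - u n) <= K / (1 - b) * (b ^+ n - b ^+ (k + n)).
  elim: k => [|k IH]; first by rewrite !add0n !subrr mulr0 rnorm0.
  rewrite addSn -(subrKA (u (k + n)%N)); apply: le_trans (rnormD _ _) _.
  apply: le_trans (lerD (h _) IH) _; rewrite exprS.
  have {1}-> : K = K / (1 - b) * (1 - b) by rewrite divfK // gt_eqF.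
  by rewrite le_eqVlt; apply/orP; left; apply/eqP; ring.
move=> /le_trans; apply; rewrite ler_wpM2l //.
by rewrite lerBlDr lerDl exprn_ge0.
Qed.

Lemma bop_bounded E F (T : bop E F) :
  exists2 K, 0 < K & forall x, rnorm (T x) <= K * rnorm x.
Proof.
have /linear_bounded_continuous/linear_boundedP := bop_continuous (b := T).
move=> [a [/complex_realP[a' ->] h]].
exists (Num.max 1 (a' + 1)); first by rewrite lt_max ltr01.
move=> x.
have /h : a'%:C < (Num.max 1 (a' + 1))%:C.
  by rewrite ltcR lt_max ltrDl ltr01 orbT.
move=> /(_ x).
by rewrite !rnormE -rmorphM lecR.
Qed.

(** Linearity comes for free from an adjoint, since a vector is determined by
    its inner products.  Operators are therefore built as bare functions whose
    adjoint is known, so that only a bound remains to be proved. *)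
Lemma linear_of_adjoint E F (f : E -> F) (g : F -> E) :
  (forall x y, inner (f x) y = inner x (g y)) -> linear f.
Proof.
move=> fg a x y; apply: inner_inj => z.
by rewrite innerDl innerZl !fg innerDl innerZl.
Qed.

Lemma bop_of_adjoint E F (f : E -> F) (g : F -> E) K :
  (forall x y, inner (f x) y = inner x (g y)) ->
  (forall x, rnorm (f x) <= K * rnorm x) ->
  exists T : bop E F, forall x, T x = f x.
Proof.
move=> fg hf; have lf := linear_of_adjoint fg.
pose fL := HB.pack_for {linear E -> F} f
  (GRing.isLinear.Build _ _ _ _ f lf).
have cf : continuous fL.
  apply/linear_bounded_continuous/linear_boundedP.
  exists K%:C; split; first by rewrite complex_real.
  move=> [r ri]; rewrite ltcE /= => /andP[/eqP -> Kr] x.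
  rewrite /= complexr0 !rnormE -rmorphM lecR; apply: le_trans (hf x) _.
  by rewrite ler_wpM2r ?rnorm_ge0 // ltW.
by exists (Bop cf).
Qed.

(** |g y|^2 = <f (g y), y> <= K |g y| |y|. *)
Lemma adjoint_bound E F (f : E -> F) (g : F -> E) K : 0 <= K ->
  (forall x y, inner (f x) y = inner x (g y)) ->
  (forall x, rnorm (f x) <= K * rnorm x) ->
  forall y, rnorm (g y) <= K * rnorm y.
Proof.
move=> K0 fg hf y; have [->|gy] := eqVneq (rnorm (g y)) 0.
  by rewrite mulr_ge0 ?rnorm_ge0.
have {}gy : 0 < rnorm (g y) by rewrite lt_def gy rnorm_ge0.
rewrite -(ler_pM2l gy) -expr2 -rinnerxx /rinner -fg.
apply: le_trans (ler_norm _) _; apply: le_trans (CauchySchwarz _ _) _.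
by rewrite mulrA (mulrC (rnorm (g y))) ler_wpM2r ?rnorm_ge0.
Qed.

End Completeness.

(** * Orthogonal projection and adjoints *)

Section Projection.
Local Open Scope classical_set_scope.
Local Open Scope ring_scope.
Variable R : realType.
Implicit Types E F : hilbertType R[i].

Lemma parallelogram E (x y : E) :
  rnorm (x - y) ^+ 2 + rnorm (x + y) ^+ 2 = 2 * rnorm x ^+ 2 + 2 * rnorm y ^+ 2.
Proof. by rewrite rnormB_sqr rnormD_sqr; ring. Qed.

Definition subspace E (D : set E) :=
  D 0 /\ forall a x y, D x -> D y -> D (a *: x + y).

(** The step t = <g, x> / |x|^2 decreases |g - t x|^2 by <g, x>^2 / |x|^2,
    which cannot exceed the defect h^2 of g from being minimal. *)
Lemma minimizer_orthogonal E (g x : E) (h m : R) : 0 <= h ->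
  rnorm g ^+ 2 <= m + h ^+ 2 ->
  (forall t : R, m <= rnorm (g - t%:C *: x) ^+ 2) ->
  `|rinner g x| <= h * rnorm x.
Proof.
move=> h0 gm hm; have x0 := rnorm_ge0 x.
have [xE|xn0] := eqVneq (rnorm x) 0.
  by have := CauchySchwarz g x; rewrite xE !mulr0.
have {}x0 : 0 < rnorm x by rewrite lt_def xn0.
rewrite -ler_sqr ?nnegrE ?mulr_ge0 ?rnorm_ge0 // real_normK ?num_real // exprMn.
have := hm (rinner g x / rnorm x ^+ 2).
rewrite rnormB_sqr rinnerZr rnormZ exprMn real_normK ?num_real //.
set r := rinner g x in gm *; set b := rnorm x in x0 xn0 *.
have -> : rnorm g ^+ 2 - 2 * (r / b ^+ 2 * r) + (r / b ^+ 2) ^+ 2 * b ^+ 2 =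
  rnorm g ^+ 2 - r ^+ 2 / b ^+ 2 by field.
move=> /le_trans /(_ (lerD gm (lexx _))).
by rewrite addrAC -addrA lerDl addrC subr_ge0 ler_pdivrMr ?exprn_gt0.
Qed.

(** By the parallelogram law a sequence d of D that minimizes the distance to f
    is Cauchy; it comes with its rate because D need not be closed. *)
Lemma projection E (D : set E) (f : E) : subspace D ->
  exists p (d : nat -> E), [/\ forall n, D (d n),
    forall n, rnorm (p - d n) <= harmonic n
    & forall x, D x -> inner (f - p) x = 0].
Proof.
move=> [D0 DD]; pose A := [set rnorm (f - x) ^+ 2 | x in D]; pose m := inf A.
have lbA : has_lbound A by exists 0 => _ [x _ <-]; exact: sqr_ge0.
have infA : has_inf A by split => //; exists (rnorm (f - 0) ^+ 2); exists 0.
have mle x : D x -> m <= rnorm (f - x) ^+ 2.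
  by move=> Dx; apply: ge_inf => //; exists x.
have h0 n : 0 < harmonic n :> R := harmonic_gt0 n.
(* With these defects the parallelogram law gives, for n <= k,
   |d k - d n|^2 <= (harmonic k ^ 2 + harmonic n ^ 2) / 2 <= harmonic n ^ 2. *)
have : forall n, exists x,
    D x /\ rnorm (f - x) ^+ 2 <= m + (harmonic n / 2) ^+ 2.
  move=> n; have e0 : 0 < (harmonic n / 2 : R) ^+ 2.
    by rewrite exprn_gt0 // divr_gt0.
  have [_ [x Dx <-] xm] := inf_adherent e0 infA.
  by exists x; split => //; exact: ltW.
move=> /choice[d /all_and2[Dd dm]].
have cd n k : (n <= k)%N -> rnorm (d k - d n) <= harmonic n.
  move=> nk; have hnk : harmonic k <= harmonic n :> R.
    by rewrite /= lef_pV2 ?posrE // ler_nat ltnS.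
  rewrite -ler_sqr ?nnegrE ?rnorm_ge0 ?(ltW (h0 _)) //.
  have := parallelogram (f - d n) (f - d k).
  have -> : f - d n - (f - d k) = d k - d n by rewrite opprB addrC subrKA.
  have Dnk : D ((2^-1)%:C *: d n + ((2^-1)%:C *: d k + 0)).
    by apply: (DD) => //; exact: DD.
  have -> : f - d n + (f - d k) =
      2%:C *: (f - ((2^-1)%:C *: d n + ((2^-1)%:C *: d k + 0))).
    rewrite addr0 -scalerDr scalerBr scalerA -rmorphM mulfV ?pnatr_eq0 //.
    by rewrite scale1r rmorph_nat scaler_nat mulr2n opprD addrACA.
  rewrite rnormZ exprMn ger0_norm //.
  have := mle _ Dnk; have := dm n; have := dm k; have := h0 k.
  move: hnk; rewrite !exprMn; set a := harmonic n; set b := harmonic k => ?????.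
  have : b ^+ 2 <= a ^+ 2 by rewrite ler_sqr ?nnegrE // ltW // h0.
  lra.
have [p pd] := complete_rate (cvg_harmonic (R := R)) cd.
exists p, d; split => //.
suff rp x : D x -> rinner (f - p) x = 0.
  move=> x Dx; apply: rinner_eq0; rewrite rp // -(addr0 ('i *: x)).
  exact: DD.
move=> Dx; apply/eqP; rewrite -normr_eq0 eq_le normr_ge0 andbT.
apply: (le0_of_vanishing (K := 2 * rnorm x) (cvg_harmonic (R := R))) => n.
have -> : f - p = (f - d n) - (p - d n) by rewrite opprB subrKA.
rewrite rinnerBl; apply: le_trans (ler_normB _ _) _.
have hn2 : 0 <= harmonic n / 2 :> R by rewrite divr_ge0 // ltW.
have := minimizer_orthogonal (x := x) hn2 (dm n).
have hm t : m <= rnorm (f - d n - t%:C *: x) ^+ 2.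
  by rewrite -addrA -opprD; apply: mle; rewrite addrC; apply: DD.
move=> /(_ hm) h1; have h2 := CauchySchwarz (p - d n) x.
have h3 := ler_wpM2r (rnorm_ge0 x) (pd n).
have h4 := mulr_ge0 hn2 (rnorm_ge0 x).
lra.
Qed.

(** The projection p of f on D satisfies f - p = 0 when only 0 is orthogonal
    to D. *)
Lemma total_dense E (D : set E) (f : E) : subspace D ->
  (forall g, (forall x, D x -> inner g x = 0) -> g = 0) ->
  exists d : nat -> E, (forall n, D (d n)) /\
    forall n, rnorm (f - d n) <= harmonic n.
Proof.
move=> sD tD; have [p [d [Dd pd /tD/eqP fp]]] := projection f sD.
by exists d; split => //; move: fp; rewrite subr_eq0 => /eqP ->.
Qed.

(** The Riesz representation of x |-> <T x, y>: outside the trivial case, it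
    is represented by a multiple of the component q, orthogonal to its kernel,
    of a vector x0 where it does not vanish. *)
Lemma adjoint_fun E F (T : bop E F) :
  exists g : F -> E, forall x y, inner (T x) y = inner x (g y).
Proof.
suff /choice[g Tg] : forall y, exists z, forall x, inner (T x) y = inner x z.
  by exists g.
move=> y; have [h0|] := pselect (forall x, inner (T x) y = 0).
  by exists 0 => x; rewrite h0 linear0r.
move=> /existsNP[x0 /eqP x00].
pose D := [set x | inner (T x) y = 0].
have sD : subspace D.
  split=> [|a x z]; rewrite /D /=; first by rewrite linear0 inner0l.
  by rewrite linearD linearZ innerDl innerZl => -> ->; rewrite mulr0 addr0.
have [p [d [Dd pd Dp]]] := projection x0 sD.
have [K K0 TK] := bop_bounded T.
have Dpp : inner (T p) y = 0.
  suff rp (z : F) : (forall n, inner (T (d n)) z = 0) -> rinner (T p) z = 0.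
    apply: rinner_eq0; apply: rp => // n.
    by rewrite innerZr (Dd n) mulr0.
  move=> Dz; apply/eqP; rewrite -normr_eq0 eq_le normr_ge0 andbT.
  apply: (le0_of_vanishing (K := K * rnorm z) (cvg_harmonic (R := R))) => n.
  have -> : rinner (T p) z = rinner (T (p - d n)) z.
    by rewrite linearB rinnerBl {3}/rinner Dz subr0.
  apply: le_trans (CauchySchwarz _ _) _; rewrite mulrAC.
  rewrite ler_wpM2r ?rnorm_ge0 //; apply: le_trans (TK _) _.
  by rewrite ler_pM2l.
pose q := x0 - p.
have Tq : inner (T q) y = inner (T x0) y by rewrite linearB innerBl Dpp subr0.
have q0 : inner q q != 0.
  rewrite (dnorm_eq0 (@inner _ E)); apply: contra_neq x00 => q0.
  by rewrite -Tq q0 linear0 inner0l.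
exists ((inner (T q) y / inner q q)^*%C *: q) => x.
have : D (x - (inner (T x) y / inner (T q) y) *: q).
  by rewrite /D /= linearB linearZ innerBl innerZl divfK ?Tq // subrr.
move=> /Dp; rewrite innerC -/q => /(congr1 conjc); rewrite conjcK conjc0.
rewrite innerBl innerZl => /eqP; rewrite subr_eq0 => /eqP.
rewrite innerZr conjcK => ->.
have Tq0 : inner (T q) y != 0 by rewrite Tq.
by field; rewrite q0 Tq0.
Qed.

Lemma adjointE E F (T : bop E F) x y : inner (T x) y = inner x (adjoint T y).
Proof.
rewrite /adjoint; case: xgetP => [S -> //|/= h]; exfalso.
have [g Tg] := adjoint_fun T; have [K K0 TK] := bop_bounded T.
have gT u v : inner (g u) v = inner u (T v).
  by rewrite innerC -Tg [RHS]innerC.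
have [S Sg] := bop_of_adjoint gT (adjoint_bound (ltW K0) Tg TK).
by apply: (h S) => /= u v; rewrite Sg.
Qed.

End Projection.

(** * Coercive operators and their inverses *)

Section Coercive.
Local Open Scope classical_set_scope.
Local Open Scope ring_scope.
Variable R : realType.
Implicit Types E F : hilbertType R[i].

Definition symmetric_op E (f : E -> E) :=
  forall x y, inner (f x) y = inner x (f y).

(** For symmetric operators this is positivity together with invertibility;
    it is the class in which square roots and inverses are constructed. *)
Definition coercive E (f : E -> E) :=
  symmetric_op f /\
  exists2 c, 0 < c & forall x, c * rnorm x ^+ 2 <= rinner (f x) x.

Lemma symmetric_real E (f : E -> E) x : symmetric_op f ->
  inner (f x) x = (rinner (f x) x)%:C.
Proof.
move=> sf; have := innerC (f x) x; rewrite -sf /rinner.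
case: (inner (f x) x) => a b /= -[/eqP]; rewrite -addr_eq0 => bb.
by have -> : b = 0 by move: bb; rewrite -mulr2n mulrn_eq0 /= => /eqP.
Qed.

Lemma rinner_symmetric E (f : E -> E) x y : symmetric_op f ->
  rinner (f x) y = rinner x (f y).
Proof. by rewrite /rinner => ->. Qed.

Lemma symmetricB E (f : E -> E) x y : symmetric_op f -> f (x - y) = f x - f y.
Proof.
move=> sf; rewrite addrC -scaleN1r (linear_of_adjoint sf) scaleN1r.
by rewrite addrC.
Qed.

Lemma symmetricZ E (f : E -> E) a x : symmetric_op f ->
  f (a *: x) = a *: f x.
Proof.
move=> sf; apply: inner_inj => z.
by rewrite sf !innerZl sf.
Qed.

(** Polarization: D u v = <A u, v> - <u, A v> vanishes on the diagonal, hence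
    is antisymmetric; replacing u by iu then gives i D u v = - i D u v. *)
Lemma positive_symmetric E (A : bop E E) : positive_op A -> symmetric_op A.
Proof.
move=> pA x y; pose D u v := inner (A u) v - inner u (A v).
have D0 u : D u u = 0.
  rewrite /D (innerC u); have := pA u; case: (inner (A u) u) => a b.
  by rewrite lecE /= => /andP[/eqP -> _]; rewrite oppr0 subrr.
have DDl u v w : D (u + v) w = D u w + D v w.
  by rewrite /D bopD !innerDl opprD addrACA.
have DDr u v w : D u (v + w) = D u v + D u w.
  by rewrite /D bopD !innerDr opprD addrACA.
have anti u v : D u v = - D v u.
  by apply/eqP; rewrite -addr_eq0; have := D0 (u + v);
     rewrite DDl !DDr !D0 add0r addr0 => ->.
have DZl u v : D ('i%C *: u) v = 'i%C * D u v.
  by rewrite /D bopZ !innerZl mulrBr.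
have DZr u v : D u ('i%C *: v) = - ('i%C * D u v).
  rewrite /D bopZ !innerZr -mulrBr -mulNr; congr (_ * _).
  by rewrite [RHS]/GRing.opp /= oppr0.
have := anti ('i%C *: x) y; rewrite DZl DZr (anti y x) mulrN opprK => /eqP.
have i0 : 'i%C != 0 :> R[i] by rewrite eq_complex /= eqxx oner_eq0.
rewrite -addr_eq0 -mulr2n mulrn_eq0 mulf_eq0 (negPf i0) /= subr_eq0.
by move=> /eqP.
Qed.

(** With c the lower and L an upper bound of A, and t = c / L^2,
    |x - t A x|^2 <= (1 - 2 t c + t^2 L^2) |x|^2 = (1 - (c / L)^2) |x|^2.
    Both the inverse and the square root of A are fixed points of maps made
    from the contraction 1 - t A. *)
Lemma coercive_contraction E (A : bop E E) : coercive A ->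
  exists t b : R, [/\ 0 < t, 0 <= b, b < 1
    & forall x, rnorm (x - t%:C *: A x) <= b * rnorm x].
Proof.
move=> [sA [c c0 Ac]]; have [K K0 AK] := bop_bounded A.
pose L := K + c; have L0 : 0 < L by rewrite addr_gt0.
have cL : c <= L by rewrite lerDr ltW.
have b0 : 0 <= 1 - (c / L) ^+ 2.
  rewrite subr_ge0 expr_le1 ?divr_ge0 ?(ltW c0) ?(ltW L0) //.
  by rewrite ler_pdivrMr ?mul1r.
exists (c / L ^+ 2), (Num.sqrt (1 - (c / L) ^+ 2)); split.
- by rewrite divr_gt0 // exprn_gt0.
- exact: sqrtr_ge0.
- by rewrite -[ltRHS]sqrtr1 ltr_sqrt // gtrBl exprn_gt0 // divr_gt0.
move=> x; rewrite -ler_sqr ?nnegrE ?mulr_ge0 ?sqrtr_ge0 ?rnorm_ge0 //.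
rewrite exprMn sqr_sqrtr // rnormB_sqr rinnerZr rnormZ exprMn.
rewrite real_normK ?num_real // (rinnerC x).
have h1 := Ac x.
have h2 : rnorm (A x) ^+ 2 <= L ^+ 2 * rnorm x ^+ 2.
  rewrite -exprMn ler_sqr ?nnegrE ?mulr_ge0 ?rnorm_ge0 ?(ltW L0) //.
  by apply: le_trans (AK x) _; rewrite ler_wpM2r ?rnorm_ge0 // lerDl ltW.
have t0 : 0 <= c / L ^+ 2 by rewrite divr_ge0 ?(ltW c0) // sqr_ge0.
have := ler_wpM2l t0 h1; have := ler_wpM2l (sqr_ge0 (c / L ^+ 2)) h2.
have -> : (c / L ^+ 2) ^+ 2 * (L ^+ 2 * rnorm x ^+ 2) =
   (c / L) ^+ 2 * rnorm x ^+ 2 by field; rewrite gt_eqF.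
have -> : c / L ^+ 2 * (c * rnorm x ^+ 2) =
   (c / L) ^+ 2 * rnorm x ^+ 2 by field; rewrite gt_eqF.
lra.
Qed.

(** A solution of t A x = y is a fixed point of x |-> y + (x - t A x). *)
Lemma coercive_surjective E (A : bop E E) y : coercive A -> exists x, A x = y.
Proof.
move=> /coercive_contraction[t [b [t0 b0 b1 Bb]]].
pose u n := iter n (fun x => y + (x - t%:C *: A x)) 0.
have uS n : u n.+1 = y + (u n - t%:C *: A (u n)) by [].
have step n : rnorm (u n.+1 - u n) <= rnorm y * b ^+ n.
  elim: n => [|n IH].
    by rewrite /u /= linear0 scaler0 !subr0 addr0 expr0 mulr1.
  have -> : u n.+2 - u n.+1 = u n.+1 - u n - t%:C *: A (u n.+1 - u n).
    by rewrite (uS n.+1) {3}(uS n) bopB; vector.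
  rewrite exprS mulrCA; apply: le_trans (Bb _) _.
  by rewrite ler_wpM2l.
have [l lu] := complete_geometric b0 b1 step.
exists (t%:C *: l); rewrite bopZ.
pose K := rnorm y / (1 - b).
apply: (eq_of_vanishing (K := 2 * K) (cvg_geometric0 b0 b1)) => n.
rewrite rnormBC.
have -> : y - t%:C *: A l =
    (u n.+1 - l) + (l - u n - t%:C *: A (l - u n)).
  by rewrite uS bopB; vector.
apply: le_trans (rnormD _ _) _.
have h1 := lu n; have h2 := Bb (l - u n).
have h3 := lu n.+1; rewrite rnormBC in h3.
have h4 : 0 <= K * b ^+ n := le_trans (rnorm_ge0 _) h1.
rewrite exprS mulrCA -/K in h3; rewrite -/K in h1.
have h5 := ler_wpM2l b0 h1.
have h6 : b * (K * b ^+ n) <= K * b ^+ n by rewrite ler_piMl // ltW.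
lra.
Qed.

Lemma coercive_bounded_below E (f : E -> E) : coercive f ->
  exists2 K, 0 < K & forall x, rnorm x <= K * rnorm (f x).
Proof.
move=> [_ [c c0 fc]]; exists c^-1; first by rewrite invr_gt0.
move=> x; rewrite ler_pdivlMl //.
have [->|xn0] := eqVneq (rnorm x) 0; first by rewrite mulr0 rnorm_ge0.
have x0 : 0 < rnorm x by rewrite lt_def xn0 rnorm_ge0.
rewrite -(ler_pM2r x0) -mulrA -expr2; apply: le_trans (fc x) _.
exact: le_trans (ler_norm _) (CauchySchwarz _ _).
Qed.

Lemma coercive_invK E (A : bop E E) : coercive A ->
  (forall x, bop_inv A (A x) = x) /\ (forall y, A (bop_inv A y) = y).
Proof.
move=> cA; rewrite /bop_inv; case: xgetP => [S -> //|/= h]; exfalso.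
have [g Ag] := choice (fun y => coercive_surjective y cA).
have [K K0 AK] := coercive_bounded_below cA.
have sg : symmetric_op g by move=> u v; rewrite -{1}(Ag v) -cA.1 Ag.
have gK u : rnorm (g u) <= K * rnorm u by rewrite -{2}(Ag u) AK.
have [S Sg] := bop_of_adjoint sg gK.
apply: (h S); split => x; rewrite Sg ?Ag //.
apply/eqP; rewrite -subr_eq0; apply/eqP/rnorm_eq0/le_anti.
rewrite rnorm_ge0 andbT; apply: le_trans (AK _) _.
by rewrite bopB Ag subrr rnorm0 mulr0.
Qed.

Lemma coercive_inv_symmetric E (A : bop E E) : coercive A ->
  symmetric_op (bop_inv A).
Proof.
move=> cA u v; have [_ Ag] := coercive_invK cA.
by rewrite -{1}(Ag v) -cA.1 Ag.
Qed.

End Coercive.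

(** * Positive square roots *)

Section Sqrt.
Local Open Scope classical_set_scope.
Local Open Scope ring_scope.
Variable R : realType.
Implicit Types E F : hilbertType R[i].

(** The iteration that gives square roots: (1 - Y)^2 = 1 - B amounts to
    Y = (B + Y^2) / 2.  On operators of norm at most b this map is again
    b-contracting, since Y^2 - Z^2 = Y (Y - Z) + (Y - Z) Z, so the iterates
    started at 0 converge geometrically.  Pointwise convergence with a rate
    proportional to |x| stands for convergence in operator norm. *)
Lemma contraction_fixpoint E (B : E -> E) b : 0 <= b -> b < 1 ->
  symmetric_op B -> (forall x, rnorm (B x) <= b * rnorm x) ->
  exists Y : E -> E, [/\ symmetric_op Y, forall x, rnorm (Y x) <= b * rnorm x
    & forall x, Y x = (2^-1)%:C *: (B x + Y (Y x))].
Proof.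
move=> b0 b1 sB Bb.
pose Y n : E -> E := iter n (fun Z x => (2^-1)%:C *: (B x + Z (Z x))) (fun=> 0).
have YS n x : Y n.+1 x = (2^-1)%:C *: (B x + Y n (Y n x)) by [].
have half0 : 0 <= 2^-1 :> R by rewrite invr_ge0.
have sY n : symmetric_op (Y n).
  elim: n => [|n IH] x y; first by rewrite /Y /= inner0l linear0r.
  by rewrite !YS innerZl innerZr innerDl innerDr sB !IH conjc_real.
have Yb n x : rnorm (Y n x) <= b * rnorm x.
  elim: n x => [|n IH] x; first by rewrite /Y /= rnorm0 mulr_ge0 ?rnorm_ge0.
  rewrite YS rnormZ ger0_norm //.
  have h1 := rnormD (B x) (Y n (Y n x)); have h2 := Bb x.
  have h3 := le_trans (IH (Y n x)) (ler_wpM2l b0 (IH x)).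
  have h4 : b * (b * rnorm x) <= b * rnorm x.
    by rewrite ler_piMl ?mulr_ge0 ?rnorm_ge0 // ltW.
  lra.
have step x n : rnorm (Y n.+1 x - Y n x) <= rnorm x * b ^+ n.
  elim: n x => [|n IH] x.
    rewrite subr0 expr0 mulr1; apply: le_trans (Yb 1%N x) _.
    by rewrite ler_piMl ?rnorm_ge0 // ltW.
  have -> : Y n.+2 x - Y n.+1 x = (2^-1)%:C *:
      (Y n.+1 (Y n.+1 x - Y n x) + (Y n.+1 (Y n x) - Y n (Y n x))).
    by rewrite (YS n.+1) {2}(YS n x) (symmetricB _ _ (sY n.+1)); vector.
  rewrite rnormZ ger0_norm //.
  have h1 := rnormD (Y n.+1 (Y n.+1 x - Y n x)) (Y n.+1 (Y n x) - Y n (Y n x)).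
  have h2 := le_trans (Yb n.+1 (Y n.+1 x - Y n x)) (ler_wpM2l b0 (IH x)).
  have h3 := le_trans (IH (Y n x)) (ler_wpM2r (exprn_ge0 n b0) (Yb n x)).
  rewrite exprS; lra.
have /choice[Z ZY] := fun x => complete_geometric b0 b1 (step x).
have v := cvg_geometric0 b0 b1.
have sZ : symmetric_op Z.
  move=> x y.
  apply: (eq_inner_of_vanishing v) => a; pose c := (1 - b)^-1.
  exists (rnorm x * c * rnorm (a *: y) + rnorm (a^*%C *: x) * (rnorm y * c)) => n.
  have -> : rinner (Z x) (a *: y) - rinner x (a *: Z y) =
      rinner (Z x - Y n x) (a *: y) - rinner (a^*%C *: x) (Z y - Y n y).
    rewrite rinnerBl rinnerBr -!rinner_scale.
    suff -> : rinner (Y n x) (a *: y) = rinner x (a *: Y n y) by ring.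
    by rewrite /rinner !innerZr sY.
  apply: le_trans (ler_normB _ _) _; rewrite mulrDl; apply: lerD.
    apply: le_trans (CauchySchwarz _ _) _.
    by rewrite mulrAC ler_wpM2r ?rnorm_ge0 // ZY.
  apply: le_trans (CauchySchwarz _ _) _.
  by rewrite -mulrA ler_wpM2l ?rnorm_ge0 // ZY.
have Zb x : rnorm (Z x) <= b * rnorm x.
  apply: (le_of_vanishing (K := rnorm x / (1 - b)) v) => n.
  have := rnormD (Y n x) (Z x - Y n x); rewrite subrKC => /le_trans; apply.
  by rewrite lerD ?Yb ?ZY.
exists Z; split => // x.
pose K := rnorm x / (1 - b).
apply: (eq_of_vanishing (K := 3 * K) v) => n.
have -> : Z x - (2^-1)%:C *: (B x + Z (Z x)) = (Z x - Y n.+1 x) -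
    (2^-1)%:C *: (Y n (Z x - Y n x) + (Z (Z x) - Y n (Z x))).
  by rewrite YS (symmetricB _ _ (sY n)); vector.
apply: le_trans (rnormB _ _) _; rewrite rnormZ ger0_norm //.
have h1 := rnormD (Y n (Z x - Y n x)) (Z (Z x) - Y n (Z x)).
have h2 := le_trans (Yb n (Z x - Y n x)) (ler_wpM2l b0 (ZY x n)).
have h3 := ZY (Z x) n; have h4 := ZY x n.+1.
have h5 : rnorm (Z x) / (1 - b) * b ^+ n <= K * b ^+ n.
  rewrite ler_wpM2r ?exprn_ge0 // ler_wpM2r ?invr_ge0 ?subr_ge0 ?(ltW b1) //.
  by apply: le_trans (Zb x) _; rewrite ler_piMl ?rnorm_ge0 // ltW.
rewrite -/K in h2 h4.
have h6 : 0 <= K * b ^+ n := le_trans (rnorm_ge0 _) (ZY x n).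
have h7 : b * (K * b ^+ n) <= K * b ^+ n by rewrite ler_piMl // ltW.
rewrite exprS mulrCA in h4.
lra.
Qed.

(** With t A = 1 - B, |B| <= b < 1, and Y the fixed point above, the operator
    S = (1 - Y) / sqrt t squares to A; it is positive because |Y| < 1. *)
Lemma coercive_sqrt_exists E (A : bop E E) : coercive A ->
  exists S : bop E E, positive_op S /\ forall x, S (S x) = A x.
Proof.
move=> cA; have [t [b [t0 b0 b1 Bb]]] := coercive_contraction cA.
have sB : symmetric_op (fun x => x - t%:C *: A x).
  by move=> x y; rewrite innerBl innerBr innerZl innerZr cA.1 conjc_real.
have [Y [sY Yb YE]] := contraction_fixpoint b0 b1 sB Bb.
pose r := (Num.sqrt t)^-1.
have r0 : 0 <= r by rewrite invr_ge0 sqrtr_ge0.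
have rt : r * r * t = 1.
  by rewrite -expr2 exprVn sqr_sqrtr ?(ltW t0) // mulVf // gt_eqF.
pose f x := r%:C *: (x - Y x).
have sf : symmetric_op f.
  move=> x y.
  by rewrite /f innerZl innerZr innerBl innerBr sY conjc_real.
have fK x : rnorm (f x) <= (r * 2) * rnorm x.
  rewrite rnormZ ger0_norm // -mulrA ler_wpM2l //.
  apply: le_trans (rnormB _ _) _.
  have h := Yb x.
  have h4 : b * rnorm x <= rnorm x by rewrite ler_piMl ?rnorm_ge0 // ltW.
  lra.
have [S Sf] := bop_of_adjoint sf fK.
exists S; split=> x; rewrite !Sf.
  rewrite symmetric_real // ler0c /f rinnerZl mulr_ge0 // rinnerBl subr_ge0.
  rewrite rinnerxx; apply: le_trans (ler_norm _) _.
  apply: le_trans (CauchySchwarz _ _) _; rewrite expr2 ler_wpM2r ?rnorm_ge0 //.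
  by apply: le_trans (Yb x) _; rewrite ler_piMl ?rnorm_ge0 // ltW.
have -> : f (f x) = r%:C *: (r%:C *: ((x - Y x) - Y (x - Y x))).
  by rewrite {1}/f (symmetricZ _ _ sY) /f -scalerBr.
rewrite scalerA (symmetricB _ _ sY).
have YY : Y (Y x) = 2%:C *: Y x - (x - t%:C *: A x).
  rewrite {2}(YE x) scalerA -rmorphM mulfV ?pnatr_eq0 // scale1r.
  by rewrite addrC addKr.
rewrite YY.
have -> : x - Y x - (Y x - (2%:C *: Y x - (x - t%:C *: A x))) = t%:C *: A x.
  by vector.
by rewrite scalerA -!rmorphM rt scale1r.
Qed.

Lemma sqrt_opP E (A : bop E E) : coercive A ->
  positive_op (sqrt_op A) /\ forall x, sqrt_op A (sqrt_op A x) = A x.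
Proof.
move=> cA; rewrite /sqrt_op; case: xgetP => [S -> //|/= h]; exfalso.
by have [S pS] := coercive_sqrt_exists cA; exact: (h S).
Qed.

(** If K bounds S, positivity at x - S x / K gives |S x|^2 <= K <S x, x>,
    and |S x|^2 = <A x, x> is bounded below. *)
Lemma sqrt_op_coercive E (A : bop E E) : coercive A -> coercive (sqrt_op A).
Proof.
move=> cA; have [pS SS] := sqrt_opP cA; set S := sqrt_op A in pS SS *.
have sS := positive_symmetric pS; split => //.
have [c c0 Ac] := cA.2; have [K K0 SK] := bop_bounded S.
exists (c / K); first exact: divr_gt0.
move=> x; rewrite mulrAC ler_pdivrMr //.
apply: le_trans (Ac x) _; rewrite -SS rinner_symmetric // rinnerxx.
have := pS (x - (K^-1)%:C *: S x); rewrite symmetric_real // ler0c.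
rewrite bopB bopZ rinnerBl !rinnerBr !rinnerZl !rinnerZr.
rewrite (rinner_symmetric (S x) x) // rinnerxx.
have := CauchySchwarz (S (S x)) (S x).
move=> /(le_trans (ler_norm _))/le_trans/(_ (ler_wpM2r (rnorm_ge0 _) (SK _))).
rewrite -mulrA -expr2; set n := rnorm (S x) ^+ 2; set p := rinner (S (S x)) _.
set q := rinner (S x) x => h1 h2.
have h3 : K^-1 * p <= n by rewrite ler_pdivrMl.
have iK : 0 < K^-1 by rewrite invr_gt0.
have := ler_wpM2l (ltW iK) h3 => h4.
have : K^-1 * n <= q by lra.
by rewrite ler_pdivrMl // mulrC.
Qed.

End Sqrt.

(** * The polar decomposition of a left-invertible operator *)

Section Polar.
Local Open Scope classical_set_scope.
Local Open Scope ring_scope.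
Variable R : realType.
Implicit Types E F : hilbertType R[i].

(** |x| = |X T x| <= K |T x| and <T* T x, x> = |T x|^2. *)
Lemma adjoint_comp_coercive E F (T : bop E F) : left_invertible T ->
  coercive (bop_comp (adjoint T) T).
Proof.
move=> [X XT]; split=> [x y|] /=.
  by rewrite -adjointE innerC -adjointE [RHS]innerC.
have [K K0 XK] := bop_bounded X; exists (K ^- 2).
  by rewrite invr_gt0 exprn_gt0.
move=> x; rewrite rinnerC /rinner -adjointE -/(rinner _ _) rinnerxx.
rewrite ler_pdivrMl ?exprn_gt0 // -exprMn ler_sqr ?nnegrE ?rnorm_ge0 //.
  by rewrite -{1}(XT x) XK.
by rewrite mulr_ge0 ?rnorm_ge0 // ltW.
Qed.

Lemma modulus_sqr E F (T : bop E F) x y : left_invertible T ->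
  rinner (modulus T x) (modulus T y) = rinner (T x) (T y).
Proof.
move=> lT; have cA := adjoint_comp_coercive lT.
have [pP PP] := sqrt_opP cA; rewrite /modulus.
rewrite (rinner_symmetric _ _ (positive_symmetric pP)) PP.
by rewrite /rinner /= -adjointE.
Qed.

Lemma modulus_coercive E F (T : bop E F) : left_invertible T ->
  coercive (modulus T).
Proof. by move=> lT; exact/sqrt_op_coercive/adjoint_comp_coercive. Qed.

(** <P^-1 x, x> = <P y, y> with y = P^-1 x. *)
Lemma modulus_inv_positive E F (T : bop E F) : left_invertible T ->
  positive_op (bop_inv (modulus T)).
Proof.
move=> lT x; have [pP _] := sqrt_opP (adjoint_comp_coercive lT).
have [_ PQ] := coercive_invK (modulus_coercive lT).
by rewrite -[X in inner _ X]PQ -(positive_symmetric pP); exact: pP.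
Qed.

(** As the modulus P is invertible, the isometry T P^-1 is a polar isometry of
    T; and any V picked by the description satisfies T = V P. *)
Lemma polar_decomposition E F (T : bop E F) x : left_invertible T ->
  T x = polar_isometry T (modulus T x).
Proof.
move=> lT; rewrite /polar_isometry; case: xgetP => [V -> [] //|/= h]; exfalso.
have [QP PQ] := coercive_invK (modulus_coercive lT).
pose V := bop_comp T (bop_inv (modulus T)).
have Vn y : rnorm (V y) = rnorm y.
  apply: (pexpIrn (n := 2)); rewrite ?nnegrE ?rnorm_ge0 //.
  by rewrite -!rinnerxx /V /= -modulus_sqr // PQ.
apply: (h V); split=> [y _|y|y]; last by rewrite /V /= QP.
  by rewrite !rnormE Vn.
split=> [/(congr1 (@rnorm _ F))|].
  by rewrite Vn rnorm0 => /rnorm_eq0 ->; rewrite linear0.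
have [X XT] := lT; rewrite -{2}(XT y) => ->.
by rewrite !linear0.
Qed.

End Polar.

(** * Families of vectors with the same inner products *)

Section Gram.
Local Open Scope classical_set_scope.
Local Open Scope ring_scope.
Variable R : realType.
Implicit Types E F : hilbertType R[i].

Definition total_family E I (e : I -> E) :=
  forall f, (forall i, inner f (e i) = 0) -> f = 0.

Lemma total_family_eq E I (e : I -> E) f g : total_family e ->
  (forall i, inner f (e i) = inner g (e i)) -> f = g.
Proof.
move=> te h; apply/eqP; rewrite -subr_eq0; apply/eqP/te => i.
by rewrite innerBl h subrr.
Qed.

Definition lincomb E I (e : I -> E) (l : seq (R[i] * I)) : E :=
  \sum_(p <- l) p.1 *: e p.2.

Lemma lincomb_subspace E I (e : I -> E) : subspace [set lincomb e l | l in setT].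
Proof.
split; first by exists nil; rewrite // /lincomb big_nil.
move=> a _ _ [l _ <-] [m _ <-]; exists ([seq (a * p.1, p.2) | p <- l] ++ m) => //.
rewrite /lincomb big_cat /= big_map scaler_sumr; congr (_ + _).
by apply: eq_bigr => p _; rewrite scalerA.
Qed.

Lemma lincomb_total_dense E I (e : I -> E) f : total_family e ->
  exists l : nat -> seq (R[i] * I),
    forall n, rnorm (f - lincomb e (l n)) <= harmonic n.
Proof.
move=> te; have [g gD|d [dD fd]] := total_dense f (lincomb_subspace e).
  apply: te => i; apply: gD; exists [:: (1, i)] => //.
  by rewrite /lincomb big_seq1 scale1r.
have /choice[l ld] : forall n, exists l, d n = lincomb e l.
  by move=> n; have [l _ <-] := dD n; exists l.
by exists l => n; rewrite -ld; exact: fd.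
Qed.

Section Transport.
Variables (E F : hilbertType R[i]) (I : Type) (a : I -> E) (b : I -> F).
Hypothesis gram : forall i j, inner (b i) (b j) = inner (a i) (a j).

Lemma lincomb_gram l m :
  inner (lincomb b l) (lincomb b m) = inner (lincomb a l) (lincomb a m).
Proof.
rewrite !inner_suml; apply: eq_bigr => p _; rewrite !inner_sumr.
apply: eq_bigr => q _; rewrite !innerZl !innerZr. by rewrite gram.
Qed.

Lemma lincomb_gram_norm l m :
  rnorm (lincomb b l - lincomb b m) = rnorm (lincomb a l - lincomb a m).
Proof.
apply: (pexpIrn (n := 2)); rewrite ?nnegrE ?rnorm_ge0 //.
by rewrite !rnormB_sqr -!rinnerxx /rinner !lincomb_gram.
Qed.

(** Approximate f by combinations of the a i.  As the Gram families agree, the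
    same combinations of the b i form a Cauchy sequence, and g is its limit. *)
Lemma gram_transport f : total_family a ->
  exists g, (forall i, inner g (b i) = inner f (a i)) /\ rnorm g <= rnorm f.
Proof.
move=> ta; have [l fl] := lincomb_total_dense f ta.
have cl n m : (n <= m)%N ->
    rnorm (lincomb b (l m) - lincomb b (l n)) <= 2 * harmonic n.
  move=> nm; rewrite lincomb_gram_norm -(subrKA f).
  apply: le_trans (rnormD _ _) _; rewrite rnormBC.
  have : harmonic m <= harmonic n :> R by rewrite /= lef_pV2 ?posrE // ler_nat ltnS.
  by have := fl n; have := fl m; lra.
have h2 : 2 * harmonic n @[n --> \oo] --> (0 : R).
  by rewrite -(mulr0 2); apply: cvgM; [exact: cvg_cst|exact: cvg_harmonic].
have [g gl] := complete_rate h2 cl.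
exists g; split.
  move=> i; apply: (eq_inner_of_vanishing h2) => c.
  exists (rnorm (c *: b i) + rnorm (c *: a i)) => n.
  have -> : rinner g (c *: b i) - rinner f (c *: a i) =
      rinner (g - lincomb b (l n)) (c *: b i) - rinner (f - lincomb a (l n)) (c *: a i).
    rewrite !rinnerBl; suff -> : rinner (lincomb b (l n)) (c *: b i) =
      rinner (lincomb a (l n)) (c *: a i) by ring.
    have := lincomb_gram (l n) [:: (c, i)].
    by rewrite /rinner /lincomb !big_seq1 => ->.
  apply: le_trans (ler_normB _ _) _; rewrite mulrDl; apply: lerD.
    apply: le_trans (CauchySchwarz _ _) _.
    by rewrite mulrC ler_wpM2l ?rnorm_ge0.
  apply: le_trans (CauchySchwarz _ _) _.
  rewrite mulrC ler_wpM2l ?rnorm_ge0 //; apply: le_trans (fl n) _.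
  by rewrite mulr2n mulrDl mul1r lerDl harmonic_ge0.
apply: (le_of_vanishing (K := 2) h2) => n.
have := rnormD (g - lincomb b (l n)) (lincomb b (l n)); rewrite subrK.
have := rnormD (lincomb a (l n) - f) f; rewrite subrK rnormBC.
have -> : rnorm (lincomb b (l n)) = rnorm (lincomb a (l n)).
  have := lincomb_gram_norm (l n) [::].
  by rewrite /lincomb !big_nil !subr0.
have := gl n; have := fl n; have := harmonic_ge0 (R := R) n; lra.
Qed.

End Transport.

Lemma isometry_inner E F (f : E -> F) :
  (forall x y, f (x + y) = f x + f y) -> (forall x, f ('i%C *: x) = 'i%C *: f x) ->
  (forall x, rnorm (f x) = rnorm x) ->
  forall x y, inner (f x) (f y) = inner x y.
Proof.
move=> fD fi fn x y.
have rf u v : rinner (f u) (f v) = rinner u v.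
  have := rnormD_sqr (f u) (f v); rewrite -fD !fn rnormD_sqr; lra.
by apply: eq_inner; rewrite -?fi rf.
Qed.

(** Transport from E to F and from F to E are inverse to each other, by
    totality, and neither increases norms.  The last clause determines U. *)
Lemma gram_unitary E F I (a : I -> E) (b : I -> F) :
  (forall i j, inner (b i) (b j) = inner (a i) (a j)) ->
  total_family a -> total_family b ->
  exists (U : bop E F) (V : bop F E), [/\ unitary U, forall y, U (V y) = y
    & forall f i, inner (U f) (b i) = inner f (a i)].
Proof.
move=> gram ta tb.
have /choice[u /all_and2[uE un]] := fun f => gram_transport gram f ta.
have gram' i j : inner (a i) (a j) = inner (b i) (b j) by [].
have /choice[v /all_and2[vE vn]] := fun f => gram_transport gram' f tb.
have vK y : u (v y) = y by apply: (total_family_eq tb) => i; rewrite uE vE.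
have uK x : v (u x) = x by apply: (total_family_eq ta) => i; rewrite vE uE.
have nu x : rnorm (u x) = rnorm x.
  by apply/le_anti; rewrite un /= -{1}(uK x) vn.
have uD x y : u (x + y) = u x + u y.
  by apply: (total_family_eq tb) => i; rewrite innerDl !uE innerDl.
have uZ x : u ('i%C *: x) = 'i%C *: u x.
  by apply: (total_family_eq tb) => i; rewrite innerZl !uE innerZl.
have iu := isometry_inner uD uZ nu.
have uv x y : inner (u x) y = inner x (v y) by rewrite -{1}(vK y) iu.
have vu x y : inner (v x) y = inner x (u y) by rewrite innerC -uv [RHS]innerC.
have u1 x : rnorm (u x) <= 1 * rnorm x by rewrite mul1r un.
have v1 x : rnorm (v x) <= 1 * rnorm x by rewrite mul1r vn.
have [U Uu] := bop_of_adjoint uv u1; have [V Vv] := bop_of_adjoint vu v1.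
exists U, V; split=> [|y|f i]; rewrite ?Uu ?Vv ?vK ?uE //.
split=> [x y|y]; first by rewrite !Uu iu.
by exists (v y); rewrite Uu vK.
Qed.

End Gram.

(** * Reproducing kernel Hilbert spaces *)

Section Rkhs.
Local Open Scope classical_set_scope.
Local Open Scope ring_scope.
Variable R : realType.
Variables (E : hilbertType R[i]) (k : R[i] -> R[i] -> bop E E).
Implicit Type H : rkhs k.

(** Restricting the index to the disc keeps out the values of kernel_at at
    outer points, about which nothing is known. *)
Definition kernel_family H (i : {w : R[i] | disc w} * E) : H :=
  kernel_at H (sval i.1) i.2.

Lemma kernel_family_total H : total_family (@kernel_family H).
Proof.
move=> f h; apply: (@rkhs_fun_inj _ _ _ H) => w dw; rewrite linear0.
apply: inner_inj => x.
by rewrite inner0l -reproducing // (h (exist _ w dw, x)).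
Qed.

Lemma kernel_gram H w z x y : disc w -> disc z ->
  inner (kernel_at H w x) (kernel_at H z y) = inner (k z w x) y.
Proof. by move=> dw dz; rewrite reproducing // kernel_atE. Qed.

(** The kernel functions of H and of H' have the same inner products, the
    values of k, and inner products with them evaluate functions. *)
Lemma rkhs_unique (H H' : rkhs k) :
  exists (U : bop H H') (V : bop H' H), [/\ unitary U, forall y, U (V y) = y
    & forall f w, disc w -> rkhs_fun H' (U f) w = rkhs_fun H f w].
Proof.
have [[[w dw] x] [[z dz] y]|U [V [uU UV UE]]] := gram_unitary (a := @kernel_family H)
  (b := @kernel_family H') _ (@kernel_family_total H) (@kernel_family_total H').
  by rewrite !kernel_gram.
exists U, V; split => // f w dw; apply: inner_inj => x.
by rewrite -!reproducing // (UE f (exist _ w dw, x)).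
Qed.

(** x |-> k(., w) x and f |-> f w are adjoint to each other, and
    |k(., w) x|^2 = <k(w, w) x, x>. *)
Lemma kernel_eval_bop H w : disc w -> exists (K : bop E H) (L : bop H E),
  (forall x, K x = kernel_at H w x) /\ (forall f, L f = rkhs_fun H f w).
Proof.
move=> dw; have kr x f : inner (kernel_at H w x) f = inner x (rkhs_fun H f w).
  by rewrite innerC reproducing // [RHS]innerC.
have rk f x : inner (rkhs_fun H f w) x = inner f (kernel_at H w x).
  by rewrite reproducing.
have [C C0 kC] := bop_bounded (k w w).
have kb x : rnorm (kernel_at H w x) <= Num.sqrt C * rnorm x.
  rewrite -ler_sqr ?nnegrE ?mulr_ge0 ?sqrtr_ge0 ?rnorm_ge0 //.
  rewrite exprMn sqr_sqrtr ?(ltW C0) // -rinnerxx /rinner kernel_gram //.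
  apply: le_trans (ler_norm _) _; apply: le_trans (CauchySchwarz _ _) _.
  by rewrite expr2 mulrA ler_wpM2r ?rnorm_ge0.
have [K KE] := bop_of_adjoint kr kb.
have [L LE] := bop_of_adjoint rk (adjoint_bound (sqrtr_ge0 _) kr kb).
by exists K, L.
Qed.

Lemma operator_kernel H (Q : bop H H) :
  exists kt : R[i] -> R[i] -> bop E E, forall z w, disc z -> disc w ->
    forall x, kt z w x = rkhs_fun H (Q (kernel_at H w x)) z.
Proof.
suff /choice[kt ktE] : forall z, exists kz : R[i] -> bop E E, forall w,
    disc z -> disc w -> forall x, kz w x = rkhs_fun H (Q (kernel_at H w x)) z.
  by exists kt.
move=> z.
suff /choice[kz kzE] : forall w, exists T : bop E E, disc z -> disc w ->
    forall x, T x = rkhs_fun H (Q (kernel_at H w x)) z by exists kz.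
move=> w; have [dz|ndz] := pselect (disc z); last by exists (bop0 E E).
have [dw|ndw] := pselect (disc w); last by exists (bop0 E E).
have [_ [L [_ LE]]] := kernel_eval_bop H dz.
have [K [_ [KE _]]] := kernel_eval_bop H dw.
by exists (bop_comp L (bop_comp Q K)) => _ _ x; rewrite /= LE KE.
Qed.

(** The double sum is <Q g, g> for g the sum of the k(., z i) (x i). *)
Lemma operator_kernel_pd H (Q : bop H H) (kt : R[i] -> R[i] -> bop E E) :
  (forall z w, disc z -> disc w ->
     forall x, kt z w x = rkhs_fun H (Q (kernel_at H w x)) z) ->
  positive_op Q -> pd_kernel kt.
Proof.
move=> ktE pQ n z x dz; pose g := \sum_(i < n) kernel_at H (z i) (x i).
suff -> : \sum_(i < n) \sum_(j < n) inner (kt (z i) (z j) (x j)) (x i) =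
    inner (Q g) g by exact: pQ.
rewrite [in RHS]/g inner_sumr; apply: eq_bigr => i _.
rewrite linear_sum inner_suml; apply: eq_bigr => j _.
by rewrite ktE // reproducing.
Qed.

Section Transported.
Variables (H : rkhs k) (J : bop H H) (kt : R[i] -> R[i] -> bop E E).
Hypotheses (J_inj : injective J) (J_sym : symmetric_op J).
Hypothesis ktE : forall z w, disc z -> disc w ->
  forall x, kt z w x = rkhs_fun H (J (J (kernel_at H w x))) z.

Let value : {linear H -> (R[i] -> E)} := rkhs_fun H \o J.

Lemma value_inj f g : (forall z, disc z -> value f z = value g z) -> f = g.
Proof. by move=> /rkhs_fun_inj /J_inj. Qed.

Lemma value_analytic f : analytic_on_disc (value f).
Proof. exact: (@rkhs_analytic _ _ _ H (J f)). Qed.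

Lemma value_kernel z w x : disc z -> disc w ->
  value (J (kernel_at H w x)) z = kt z w x.
Proof. by move=> dz dw; rewrite ktE. Qed.

Lemma value_reproducing f w x : disc w ->
  inner f (J (kernel_at H w x)) = inner (value f w) x.
Proof. by move=> dw; rewrite -J_sym reproducing. Qed.

(** Reading f as the function J f keeps the Hilbert space and changes the kernel:
    as J is self-adjoint, (J f)(w) is reproduced by J k(., w) x, and this element
    is in turn read as J J k(., w) x. *)
Definition transported_rkhs : rkhs kt :=
  Rkhs value_inj value_analytic value_kernel value_reproducing.

End Transported.

End Rkhs.

Theorem theorem7p7 (R : realType) (E : hilbertType R[i])
    (k : R[i] -> R[i] -> bop E E) (hk : analytic_kernel k)
    (H : rkhs k) (M : bop H H) (hM : is_shift M) (hMl : left_invertible M) :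
  exists kt : R[i] -> R[i] -> bop E E,
    [/\ forall z w : R[i], disc z -> disc w -> forall eta zeta : E,
          inner (kt z w eta) zeta
          = inner (bop_inv (modulus M) (kernel_at H w eta)) (kernel_at H z zeta),
        pd_kernel kt,
        inhabited (rkhs kt)
      & forall Ht : rkhs kt, exists Mt : bop Ht Ht, is_shift Mt /\
          exists U : bop H Ht, unitary U /\
            forall f : H, U (aluthge M f) = Mt (U f)].
Proof.
have cP := modulus_coercive hMl; have cS := sqrt_op_coercive cP.
have [_ SS] := sqrt_opP cP.
have polar f := polar_decomposition f hMl.
have [_ PQ] := coercive_invK cP; have [JS SJ] := coercive_invK cS.
have J_sym := coercive_inv_symmetric cS.
have Q_pos := modulus_inv_positive hMl.
set P := modulus M in cP cS SS polar PQ JS SJ J_sym Q_pos *.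
set S := sqrt_op P in cS SS JS SJ J_sym *.
set Q := bop_inv P in PQ Q_pos *; set J := bop_inv S in JS SJ J_sym.
have JJ x : J (J x) = Q x by rewrite -{1}(PQ x) -SS !JS.
have J_inj : injective J := can_inj SJ.
have [kt ktE] := operator_kernel Q.
have ktJ z w (dz : disc z) (dw : disc w) x :
    kt z w x = rkhs_fun H (J (J (kernel_at H w x))) z by rewrite JJ ktE.
pose H0 := transported_rkhs J_inj J_sym ktJ.
exists kt; split.
- by move=> z w dz dw x y; rewrite ktE // reproducing.
- exact: operator_kernel_pd ktE Q_pos.
- exact: inhabits H0.
move=> Ht; have [U [V [uU UV UE]]] := rkhs_unique H0 Ht.
exists (bop_comp U (bop_comp (aluthge M) V)); split.
  move=> f w dw; rewrite -{2}(UV f) /= !UE //=.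
  (* Here the value at w of the Aluthge transform of an element h of H0 is that
     of S^-1 (S V S) h = V P (S^-1 h) = M (S^-1 h). *)
  by rewrite JS -{1}(SJ (V f)) SS -polar; exact: hM.
exists U; split => // f /=.
suff -> : V (U f) = f by [].
by apply: inner_inj => g; rewrite -uU.1 UV uU.1.
Qed.
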